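(* Let $r\ge 3$ be an integer and let $\sigma$ be a partition of $r$ with $s=s(\sigma)\ge 2$ parts, with $\delta(\sigma)=1$ and with largest part $\Delta=\Delta(\sigma)>1$. Let $n$ be an integer with $n>r(s-1)+s$, let $q=(r-1)(\Delta-1)$, and let $\mathcal{H}=\mathcal{H}(n,r,q|\sigma)$. Then $\mathcal{H}$ has a gap in its NMNR spectrum between $r-1$ and $\lceil n/(s-1)\rceil$. More specifically: (1) $\mathcal{H}$ is not $k$-NMNR colourable for any positive integer $k\le r-2$; (2) $\mathcal{H}$ is $(r-1)$-NMNR colourable; (3) $\mathcal{H}$ is not $r$-NMNR colourable; (4) $\mathcal{H}$ is $k$-NMNR colourable for every integer $k$ with $\lceil n/(s-1)\rceil\le k\le n$.
   Context: For positive integers $n,r,q$ with $r\ge 3$ and a partition $\sigma$ of the integer $r$ (into positive parts), the $\sigma$-hypergraph $\mathcal{H}(n,r,q|\sigma)$ has $nq$ vertices, partitioned into $n$ classes $V_1,\dots,V_n$ each containing $q$ vertices; an $r$-subset $R$ of the vertices is an edge if and only if the non-zero cardinalities among $|R\cap V_i|$, $1\le i\le n$, form (as a multiset) the partition $\sigma$ of $r$. $\Delta(\sigma)$, $\delta(\sigma)$ and $s(\sigma)$ denote the size of the largest part, the size of the smallest part, and the number of parts (counted with multiplicity) of $\sigma$, respectively. It is assumed throughout that $s(\sigma)\ge 2$. A $k$-NMNR (non-monochromatic non-rainbow) colouring of a hypergraph is a colouring of its vertices using exactly $k$ distinct colours (all $k$ are used) such that no edge has all its vertices of the same colour and no edge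 has all its vertices of pairwise distinct colours. A hypergraph is $k$-NMNR colourable if it has a $k$-NMNR colouring. Its NMNR spectrum is the set of all positive integers $k$ for which it is $k$-NMNR colourable; the spectrum has a gap if there are $k_1<k_2<k_3$ with $k_1,k_3$ in the spectrum and $k_2$ not in the spectrum. *)

(* Defs.v *)
From mathcomp Require Import all_boot.

Set Implicit Arguments.
Unset Strict Implicit.
Unset Printing Implicit Defensive.

(* An integer partition is a list of parts whose order is irrelevant: it is
   only ever used up to perm_eq. *)
Definition is_partition (r : nat) (sigma : seq nat) : bool :=
  all (fun p => 0 < p) sigma && (sumn sigma == r).

Definition largest_part (sigma : seq nat) : nat := \max_(p <- sigma) p.

(* The neutral value head 0 sigma is itself a part when sigma is nonempty. *)
Definition smallest_part (sigma : seq nat) : nat :=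
  \big[minn/head 0 sigma]_(p <- sigma) p.

Definition num_parts (sigma : seq nat) : nat := size sigma.

Section SigmaHypergraph.

Variables n r q : nat.

Definition vertex : finType := ('I_n * 'I_q)%type.

Definition vclass (i : 'I_n) : {set vertex} := [set v | v.1 == i].

Definition class_profile (R : {set vertex}) : seq nat :=
  [seq m <- [seq #|R :&: vclass i| | i <- enum 'I_n] | m != 0].

Definition sigma_hypergraph (sigma : seq nat) : {set {set vertex}} :=
  [set R : {set vertex} | (#|R| == r) && perm_eq (class_profile R) sigma].

End SigmaHypergraph.

Section NMNR.

Variables (T : finType) (E : {set {set T}}).

Definition monochromatic (C : Type) (c : T -> C) (e : {set T}) : Prop :=
  {in e &, forall x y, c x = c y}.

Definition rainbow (C : Type) (c : T -> C) (e : {set T}) : Prop :=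
  {in e &, injective c}.

Definition NMNR_colouring (k : nat) (c : T -> 'I_k) : Prop :=
  (forall a : 'I_k, exists x : T, c x = a) /\
  (forall e : {set T}, e \in E -> ~ monochromatic c e /\ ~ rainbow c e).

Definition NMNR_colourable (k : nat) : Prop :=
  exists c : T -> 'I_k, NMNR_colouring c.

Definition NMNR_spectrum (k : nat) : Prop := 0 < k /\ NMNR_colourable k.

Definition NMNR_gap_between (k1 k3 : nat) : Prop :=
  [/\ NMNR_spectrum k1, NMNR_spectrum k3 &
      exists k2 : nat, k1 < k2 < k3 /\ ~ NMNR_spectrum k2].

End NMNR.

Definition ceil_div (m d : nat) : nat := (m + d.-1) %/ d.

(* Main.v *)
Require Import Defs.
From mathcomp Require Import all_boot zify.

Set Implicit Arguments.
Unset Strict Implicit.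
Unset Printing Implicit Defensive.

(** For (1) and (3), suppose no edge is monochromatic. For each colour, fewer
    than [s] classes hold [Delta] vertices of it, so with [k] colours at most
    [k (s - 1)] classes repeat some colour [Delta] times. Every other class
    shows at least [q / (Delta - 1) = r - 1] colours, which rules out
    [k <= r - 2]. For [k = r], more than [s] classes each miss at most one
    colour, and a rainbow edge arises greedily: fix such a class [G], a vertex
    [w] outside [G] whose colour is the only one [G] may miss (the part 1 of
    [sigma]), serve the other parts from other such classes, and [G] last. Each
    intermediate class finds enough fresh colours because at least one fresh
    colour is left over for [G].
    For (2), colour each class with [r - 1] colours, each used [Delta - 1]
    times; for (4), colour classes monochromatically, each colour being used
    on at most [s - 1] classes. *)

(** * Choosing subsets of given size; extreme parts of a partition *)

Lemma ex_subset_card (T : finType) (A : {set T}) (m : nat) :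
  m <= #|A| -> exists2 B : {set T}, B \subset A & #|B| = m.
Proof.
move=> mA; exists [set x in take m (enum A)].
  by apply/subsetP => x; rewrite inE => /mem_take; rewrite mem_enum.
rewrite cardsE; have /card_uniqP -> : uniq (take m (enum A)).
  exact/take_uniq/enum_uniq.
by rewrite size_takel // -cardE.
Qed.

Lemma ex_uniq_seq (T : finType) (A : {set T}) (m : nat) :
  m <= #|A| -> exists l : seq T, [/\ uniq l, size l = m & {subset l <= A}].
Proof.
move=> mA; exists (take m (enum A)); split; first exact/take_uniq/enum_uniq.
  by rewrite size_takel // -cardE.
by move=> x /mem_take; rewrite mem_enum.
Qed.

Lemma smallest_part_mem (sigma : seq nat) :
  0 < size sigma -> smallest_part sigma \in sigma.
Proof.
rewrite /smallest_part; case: sigma => // x s _ /=; rewrite big_seq.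
apply: (big_ind (fun y => y \in x :: s)) => //; first exact: mem_head.
by move=> a b; rewrite /minn; case: ifP.
Qed.

Lemma leq_largest_part (sigma : seq nat) (p : nat) :
  p \in sigma -> p <= largest_part sigma.
Proof. by move=> ps; rewrite /largest_part (leq_bigmax_seq p). Qed.

Lemma largest_part_mem (sigma : seq nat) :
  0 < largest_part sigma -> largest_part sigma \in sigma.
Proof.
rewrite /largest_part; elim: sigma => [|x s IH]; first by rewrite big_nil.
rewrite big_cons inE /maxn; case: ifP => [lt_x _|]; last by rewrite eqxx.
by rewrite IH ?orbT //; apply: leq_trans lt_x.
Qed.

(** * Building edges class by class, and reading off their class sizes *)

Section Profile.

Variables n r q : nat.
Implicit Types (R B A : {set vertex n q}) (l : seq 'I_n) (i : 'I_n).

Definition has_profile R l (ps : seq nat) : Prop :=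
  [/\ uniq l, {in R, forall v, v.1 \in l} &
      [seq #|R :&: vclass q i| | i <- l] = ps].

Lemma has_profile0 : has_profile set0 [::] [::].
Proof. by split=> // v; rewrite inE. Qed.

Lemma has_profile_extend R B l ps i :
    has_profile R l ps -> i \notin l -> B \subset vclass q i ->
  has_profile (B :|: R) (i :: l) (#|B| :: ps).
Proof.
move=> [ul Rl <-] il /subsetP Bi; split=> /=; first by rewrite il.
  by move=> v /setUP[/Bi|/Rl vl]; rewrite !inE ?vl ?orbT // => ->.
congr (_ :: _).
  congr #|pred_of_set _|; apply/setP=> v; rewrite !inE.
  case vB: (v \in B) => /=; first by have := Bi _ vB; rewrite inE.
  apply/andP=> -[/Rl vl /eqP vi]; by rewrite -vi vl in il.
apply/eq_in_map => j jl; congr #|pred_of_set _|; apply/setP=> v; rewrite !inE.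
case vB: (v \in B) => //=; have := Bi _ vB; rewrite inE => /eqP->.
by case: eqP il => [->|_ _]; [rewrite jl | rewrite andbF].
Qed.

Lemma sum_card_vclass R : \sum_(i < n) #|R :&: vclass q i| = #|R|.
Proof.
rewrite -sum1_card (partition_big (fun v => v.1) predT) //=.
by apply: eq_bigr => i _; rewrite -sum1_card; apply: eq_bigl => v; rewrite !inE.
Qed.

Lemma sumn_class_profile R : sumn (class_profile R) = #|R|.
Proof.
rewrite -sum_card_vclass sumnE big_filter big_map big_enum_cond /=.
rewrite [RHS](bigID (fun i => #|R :&: vclass q i| != 0)) /=.
rewrite [X in _ = _ + X]big1 ?addn0 //.
by move=> i /negPn/eqP.
Qed.

Lemma has_profile_edge sigma R l ps :
    is_partition r sigma -> has_profile R l ps -> perm_eq ps sigma ->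
  R \in sigma_hypergraph n r q sigma.
Proof.
move=> /andP[pos /eqP sum_r] [ul Rl Rps] ps_sigma.
have prof : perm_eq (class_profile R) sigma.
  rewrite -(permPr ps_sigma) -Rps /class_profile.
  (* With [l] listed first, the remaining classes contribute only zeros, while positivity of the
     parts keeps every entry of [l]. *)
  have perm_l : perm_eq (enum 'I_n) (l ++ [seq i <- enum 'I_n | i \notin l]).
    apply: uniq_perm; first exact: enum_uniq.
      rewrite cat_uniq ul filter_uniq ?enum_uniq // andbT /=.
      by apply/hasPn=> i; rewrite mem_filter => /andP[].
    by move=> i; rewrite mem_cat [in RHS]mem_filter !mem_enum andbT orbN.
  rewrite (permPl (perm_filter _ (perm_map _ perm_l))) map_cat filter_cat.
  rewrite (_ : filter _ (map _ [seq _ <- _ | _]) = [::]) ?cats0.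
    rewrite (_ : filter _ _ = [seq #|R :&: vclass q i| | i <- l]) //.
    apply/all_filterP; rewrite Rps (perm_all _ ps_sigma).
    by apply: sub_all pos => p; rewrite lt0n.
  apply/eqP; rewrite -[_ == _]negbK -has_filter; apply/hasPn=> m /mapP[i].
  rewrite mem_filter => /andP[il _] ->; rewrite negbK cards_eq0.
  apply/eqP/setP=> v; rewrite !inE; apply/andP=> -[/Rl vl /eqP vi].
  by rewrite -vi vl in il.
by rewrite inE prof -sumn_class_profile (perm_sumn prof) sum_r eqxx.
Qed.

Lemma edge_subset sigma A l :
    is_partition r sigma -> uniq l -> size l = size sigma ->
    {in l, forall i, largest_part sigma <= #|A :&: vclass q i|} ->
  exists2 R : {set vertex n q}, R \in sigma_hypergraph n r q sigma & R \subset A.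
Proof.
move=> part ul sz big_l.
have [R RA Rl] : exists2 R : {set vertex n q}, R \subset A & has_profile R l sigma.
  (* The largest part may change when passing to a tail of [sigma], so the induction carries a bound
     for each part instead. *)
  have : {in sigma, forall p, {in l, forall i, p <= #|A :&: vclass q i|}}.
    by move=> p /leq_largest_part pD i /big_l; apply: leq_trans.
  elim: l {part big_l}sigma ul sz => [|i l IH] [|p ps] //=.
    by exists set0; rewrite ?sub0set //; apply: has_profile0.
  move=> /andP[il ul] [sz] big_l.
  have [|R RA Rl] := IH ps ul sz.
    by move=> p' p'ps j jl; apply: big_l; rewrite inE ?p'ps ?jl orbT.
  have [|B + <-] := @ex_subset_card _ (A :&: vclass q i) p.
    by apply: big_l; apply: mem_head.
  rewrite subsetI => /andP[BA Bi]; exists (B :|: R); first by rewrite subUset BA.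
  exact: has_profile_extend.
by exists R => //; apply: has_profile_edge Rl _.
Qed.

Lemma card_vclass i : #|vclass q i| = q.
Proof.
rewrite (_ : vclass q i = [set (i, j) | j in 'I_q]).
  by rewrite card_imset ?card_ord // => x y [].
apply/setP=> -[a b]; rewrite !inE; apply/eqP/imsetP => /= [->|[j _ [-> _]] //].
by exists b.
Qed.

Lemma edge_vclass sigma R p :
    R \in sigma_hypergraph n r q sigma -> p \in sigma ->
  exists i, #|R :&: vclass q i| = p.
Proof.
rewrite inE => /andP[_ /perm_mem <-].
by rewrite mem_filter => /andP[_ /mapP[i _ ->]]; exists i.
Qed.

Lemma edge_num_classes sigma R :
    R \in sigma_hypergraph n r q sigma ->
  #|[set v.1 | v in R]| = size sigma.
Proof.
rewrite inE => /andP[_ /perm_size <-].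
rewrite /class_profile size_filter count_map cardE enumT size_filter.
apply: eq_count => i /=.
rewrite cards_eq0; apply/imsetP/set0Pn => [[v vR ->]|[v]].
  by exists v; rewrite !inE vR eqxx.
by rewrite !inE => /andP[vR /eqP <-]; exists v.
Qed.

End Profile.

(** * Colours seen by a class, and the construction of rainbow edges *)

Section Colouring.

Variables (n q k : nat) (c : vertex n q -> 'I_k).
Implicit Types (R B : {set vertex n q}) (l : seq 'I_n) (i : 'I_n).
Implicit Types (a : 'I_k) (D : {set 'I_k}).

Definition colour_class a : {set vertex n q} := [set v | c v == a].

Definition class_colours i : {set 'I_k} := [set c v | v in vclass q i].

Lemma colours_lower_bound d i :
  (forall a, #|colour_class a :&: vclass q i| <= d) ->
  q <= #|class_colours i| * d.
Proof.
move=> small; rewrite -[X in X <= _](card_vclass q i) -sum1_card.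
rewrite (partition_big c (mem (class_colours i))) /=; last first.
  by move=> v vi; apply: imset_f.
rewrite -sum_nat_const; apply: leq_sum => a _; apply: leq_trans (small a).
by rewrite sum1dep_card subset_leq_card //; apply/subsetP=> v; rewrite !inE andbC.
Qed.

(** Choose one vertex of the class for each colour of [D]; [f] makes the choice a function of the
    colour. *)
Lemma rainbow_lift i D :
    D \subset class_colours i ->
  exists B : {set vertex n q}, [/\ B \subset vclass q i, rainbow c B & c @: B = D].
Proof.
move=> /subsetP Di; pose f a := [pick v in vclass q i | c v == a].
exists [set v in vclass q i | (c v \in D) && (f (c v) == Some v)]; split.
- by apply/subsetP=> v; rewrite inE => /andP[].
- move=> u v; rewrite !inE => /and3P[_ _ /eqP fu] /and3P[_ _ /eqP fv] cuv.
  by move: fu; rewrite cuv fv => -[].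
apply/setP=> a; apply/imsetP/idP => [[v]|aD].
  by rewrite inE => /and3P[_ vD _] ->.
have /imsetP[w wi aw] := Di _ aD.
case fa: (f a) => [v|]; move: (fa); rewrite /f; case: pickP => //.
  move=> u /andP[ui /eqP ua] [uv]; rewrite uv in ui ua.
  by exists v => //; rewrite inE ui ua aD -/(f a) fa eqxx.
by move=> /(_ w); rewrite wi aw eqxx.
Qed.

Lemma rainbowU R B :
    rainbow c R -> rainbow c B -> [disjoint c @: R & c @: B] ->
  rainbow c (B :|: R).
Proof.
move=> rR rB dis.
have sep u v : u \in R -> v \in B -> c u <> c v.
  move=> uR vB cuv; have /pred0P/(_ (c u)) := dis.
  by rewrite /= imset_f // cuv imset_f.
move=> u v /setUP[uB|uR] /setUP[vB|vR] cuv; [exact: rB | | | exact: rR].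
- by case: (sep v u vR uB).
- by case: (sep u v uR vB).
Qed.

Definition rainbow_profile R l ps : Prop :=
  [/\ has_profile R l ps, rainbow c R & #|c @: R| = sumn ps].

Lemma rainbow_profile_extend R l ps i D :
    rainbow_profile R l ps -> i \notin l -> D \subset class_colours i ->
    [disjoint c @: R & D] ->
  exists2 R' : {set vertex n q}, rainbow_profile R' (i :: l) (#|D| :: ps) &
    c @: R' = D :|: c @: R.
Proof.
move=> [prof rR cR] il /rainbow_lift[B [Bi rB cB]] dis.
exists (B :|: R); last by rewrite imsetU cB.
have BD : #|B| = #|D| by rewrite -cB card_in_imset.
split; first by rewrite -BD; apply: has_profile_extend.
- by apply: rainbowU; rewrite ?cB.
- rewrite imsetU cB cardsU /= -cR setIC.
  by move: dis; rewrite -setI_eq0 => /eqP ->; rewrite cards0 subn0.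
Qed.

Lemma rainbow_greedy D l ps :
    uniq l -> size l = size ps -> sumn ps < #|D| ->
    {in l, forall i, #|D :\: class_colours i| <= 1} ->
  exists2 R : {set vertex n q}, rainbow_profile R l ps & c @: R \subset D.
Proof.
elim: l ps => [|i l IH] [|p ps] //=.
  move=> _ _ _ _; exists set0; last by rewrite imset0 sub0set.
  split; [exact: has_profile0 | by move=> v; rewrite inE |].
  by rewrite imset0 cards0.
move=> /andP[il ul] [sz] psD miss.
have [|j jl|R prof RD] := IH ps ul sz.
- by apply: leq_ltn_trans psD; apply: leq_addl.
- by apply: miss; rewrite inE jl orbT.
have [] := @ex_subset_card _ ((D :\: c @: R) :&: class_colours i) p.
  have := cardsID (class_colours i) (D :\: c @: R).
  have : #|D :\: c @: R| = #|D| - sumn ps.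
    by case: prof => _ _ <-; rewrite cardsD (setIidPr RD).
  have : #|(D :\: c @: R) :\: class_colours i| <= 1.
    apply: leq_trans (miss i (mem_head _ _)).
    by apply/subset_leq_card/setSD/subsetDl.
  by move: psD => /=; lia.
move=> D' + D'p; rewrite subsetI subsetD => /andP[/andP[D'D dis] D'i].
have [|R' prof' R'c] := rainbow_profile_extend prof il D'i.
  by rewrite disjoint_sym.
by exists R'; rewrite -?D'p // R'c subUset D'D.
Qed.

Definition repeating_classes (d : nat) : {set 'I_n} :=
  [set i | [exists a, d <= #|colour_class a :&: vclass q i|]].

(** If one colour filled [largest_part sigma] vertices in [size sigma] classes, an edge would fit
    inside that colour. A union bound over the [k] colours follows. *)
Lemma card_repeating_classes r sigma :
    is_partition r sigma ->
    (forall R, R \in sigma_hypergraph n r q sigma -> ~ monochromatic c R) ->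
    0 < size sigma ->
  #|repeating_classes (largest_part sigma)| <= k * (size sigma - 1).
Proof.
move=> part no_mono s_gt0; set d := largest_part sigma.
pose rep a := [set i | d <= #|colour_class a :&: vclass q i|].
have rep_small a : #|rep a| <= size sigma - 1.
  rewrite leqNgt; apply/negP=> big_rep.
  have [|l [ul sz lrep]] := @ex_uniq_seq _ (rep a) (size sigma); first lia.
  have [|R Re /subsetP Ra] := @edge_subset _ _ _ _ (colour_class a) _ part ul sz.
    by move=> i /lrep; rewrite inE.
  apply: (no_mono _ Re) => u v /Ra + /Ra.
  by rewrite !inE => /eqP -> /eqP ->.
have -> : repeating_classes d = \bigcup_a rep a.
  apply/setP=> i; rewrite inE; apply/existsP/bigcupP => [[a ia]|[a _]].
    by exists a; rewrite ?inE.
  by rewrite inE => ia; exists a.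
apply: leq_trans (_ : \sum_a #|rep a| <= _).
  elim/big_rec2: _ => [|a m A _ Am]; first by rewrite cards0.
  apply: leq_trans (leq_card_setU _ _).1 _; by rewrite leq_add2l.
rewrite -[X in _ <= X * _]card_ord -sum_nat_const; exact: leq_sum.
Qed.

Lemma class_colours_lower_bound d m i :
    0 < d -> q = m * d -> i \notin repeating_classes d.+1 ->
  m <= #|class_colours i|.
Proof.
move=> d_gt0 q_eq; rewrite inE negb_exists => /forallP small.
rewrite -(leq_pmul2r d_gt0) -q_eq; apply: colours_lower_bound => a.
by rewrite -ltnS ltnNge.
Qed.

(** If class [i] shows all colours, any vertex elsewhere will do. Otherwise its unique missing
    colour occurs at some [w], necessarily outside the class. *)
Lemma ex_vertex_supplying_colour i :
    1 < n -> 0 < q -> k <= #|class_colours i|.+1 ->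
    (forall a, exists v, c v = a) ->
  exists2 w : vertex n q, w.1 != i & [set: 'I_k] :\ c w \subset class_colours i.
Proof.
move=> n_gt1 q_gt0 many surj.
have miss1 : #|~: class_colours i| <= 1.
  by have := cardsC (class_colours i); rewrite card_ord; lia.
have [all|[a a_miss]] := set_0Vmem (~: class_colours i).
  have [j ji] : exists j, j != i.
    have /card_gt0P[j] : 0 < #|[set~ i]| by rewrite cardsC1 card_ord; lia.
    by rewrite !inE => ji; exists j.
  exists (j, Ordinal q_gt0) => //; apply/subsetP=> b _.
  by apply: contraT; rewrite -in_setC all inE.
have [w cw] := surj a; exists w.
  apply: contraTneq a_miss => wi; rewrite inE negbK -cw.
  by apply: imset_f; rewrite inE wi.
apply/subsetP=> b; rewrite cw !inE andbT => ba.
rewrite -[b \in _]negbK -in_setC; apply: contra ba => b_miss.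
by apply/eqP; apply: (card_le1_eqP miss1).
Qed.

(** The edge size equals the number [k] of colours, so the edge has to use every colour exactly
    once. *)
Lemma ex_rainbow_edge sigma (good : {set 'I_n}) :
    is_partition k sigma -> 1 \in sigma -> 1 < size sigma -> 0 < q ->
    (forall a, exists v, c v = a) ->
    {in good, forall i, k - 1 <= #|class_colours i|} ->
    size sigma < #|good| ->
  exists2 R : {set vertex n q}, R \in sigma_hypergraph n k q sigma & rainbow c R.
Proof.
move=> part one_sigma s_gt1 q_gt0 surj many good_many.
have n_ge : #|good| <= n by rewrite -[X in _ <= X]card_ord max_card.
(* The part 1 is meant for [w], the part [p] for the class [g], and [ps] for the greedy choice. *)
have [p [ps perm_s]] : exists p ps, perm_eq sigma [:: 1, p & ps].
  have := perm_to_rem one_sigma; have := size_rem one_sigma.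
  by case: (rem 1 sigma) => [|p ps] /=; [lia | by exists p, ps].
have size_ps : size sigma = (size ps).+2 by rewrite (perm_size perm_s).
have [p_gt0 sum_ps] : 0 < p /\ k = 1 + p + sumn ps.
  move: part => /andP[]; rewrite (perm_all _ perm_s) (perm_sumn perm_s) /=.
  by move=> /andP[-> _] /eqP <-; rewrite addnA.
have /card_gt0P[g g_good] : 0 < #|good| by lia.
have [||w wg Dg] := @ex_vertex_supplying_colour g _ q_gt0 _ surj; first lia.
  by have := many g g_good; lia.
set D := _ :\ _ in Dg.
have cardD : #|D| = p + sumn ps.
  by rewrite /D setTD cardsC1 card_ord; lia.
have [|l [ul sz lgood]] := @ex_uniq_seq _ (good :\ g :\ w.1) (size ps).
  have := cardsD1 g good; have := cardsD1 w.1 (good :\ g).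
  by rewrite g_good; case: (w.1 \in _); move: good_many; rewrite /reverse_coercion /=; lia.
(* The strict bound [sumn ps < #|D|] comes from [p_gt0]: the share of [g] provides the slack. *)
have [||R prof RD] := @rainbow_greedy D _ _ ul sz; first lia.
  move=> i /lgood; rewrite !inE => /and3P[_ _ /many].
  have := cardsC (class_colours i); rewrite card_ord.
  have := subset_leq_card (setSD (class_colours i) (subsetT D)).
  by rewrite setTD; lia.
have gl : g \notin l by apply/negP=> /lgood; rewrite !inE eqxx /= andbF.
(* The class [g] shows all of [D], so it can take exactly the leftover colours; there are [p] of
   them. *)
have [||R1 prof1 R1c] :=
  @rainbow_profile_extend R l ps g (D :\: c @: R) prof gl.
- by apply: subset_trans Dg; apply: subsetDl.
- by rewrite -setI_eq0; apply/eqP/setP=> a; rewrite !inE; case: (a \in c @: R).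
have wl : w.1 \notin g :: l.
  by rewrite inE negb_or wg; apply/negP=> /lgood; rewrite !inE eqxx.
(* The colour of [w] is still fresh, since everything so far uses colours of [D] only. *)
have [||R2 [prof2 rain2 _] _] :=
  @rainbow_profile_extend R1 _ _ w.1 [set c w] prof1 wl.
- by rewrite sub1set; apply: imset_f; rewrite inE.
- by rewrite disjoint_sym disjoints1 R1c !inE eqxx /= andbF /=;
    apply: contra (subsetP RD (c w)) _; rewrite !inE eqxx.
exists R2 => //; apply: has_profile_edge part prof2 _.
rewrite perm_sym cards1.
suff -> : #|D :\: c @: R| = p by [].
by case: prof => _ _ cR; rewrite cardsD (setIidPr RD) cardD cR; lia.
Qed.

End Colouring.

(** * The two explicit colourings *)

Lemma ceil_div_leq (m d : nat) : 0 < d -> m <= ceil_div m d * d.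
Proof.
move=> d_gt0; rewrite /ceil_div.
by have := divn_eq (m + d.-1) d; have := ltn_pmod (m + d.-1) d_gt0; lia.
Qed.

(** Class [i] gets colour [i %% k]. A monochromatic edge would need [size sigma] classes of one
    residue, and two vertices of an edge in a common class rule out rainbow. *)
Lemma class_mod_colourable n r q sigma k :
    0 < q -> 1 < largest_part sigma -> 0 < k -> k <= n ->
    n <= k * (size sigma - 1) ->
  NMNR_colourable (sigma_hypergraph n r q sigma) k.
Proof.
move=> q_gt0 Delta_gt1 k_gt0 kn nk.
exists (fun v : vertex n q => Ordinal (ltn_pmod v.1 k_gt0)); split.
  move=> a; exists (Ordinal (leq_trans (ltn_ord a) kn), Ordinal q_gt0).
  by apply: val_inj => /=; rewrite modn_small.
move=> R Re; split.
  move=> mono; have := edge_num_classes Re; set I := imset _ _ => cardI.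
  have /card_gt0P[i0 i0I] : 0 < #|I| by lia.
  have same i : i \in I -> i %% k = i0 %% k.
    move: i0I => /imsetP[v vR ->] /imsetP[u uR ->].
    by have [] := mono _ _ uR vR.
  have s_gt0 : 0 < size sigma - 1 by lia.
  (* Classes of equal residue are told apart by their quotients, which are below [size sigma - 1] by
     [nk]; the default of [insubd] is never reached. *)
  pose h (i : 'I_n) : 'I_(size sigma - 1) := insubd (Ordinal s_gt0) (i %/ k).
  have h_inj : {in I &, injective h}.
    move=> i j iI jI /(congr1 val); rewrite !val_insubd.
    rewrite !ltn_divLR // ![(_ - 1) * k]mulnC.
    rewrite !(leq_trans (ltn_ord _) nk) => ij; apply: val_inj => /=.
    by rewrite (divn_eq i k) (divn_eq j k) ij !same.
  have := subset_leq_card (subsetT (h @: I)).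
  by rewrite card_in_imset // cardsT card_ord; lia.
have [|i cardi] := edge_vclass Re (@largest_part_mem sigma _); first lia.
move=> rain; have /card_gt1P[u [v [+ + /eqP uv]]] :
  1 < #|R :&: vclass q i| by rewrite cardi.
rewrite !inE => /andP[uR /eqP ui] /andP[vR /eqP vi]; apply: uv.
by apply: rain => //; apply: val_inj; rewrite /= ui vi.
Qed.

(** Colour by position in the class modulo [k]. Each colour occurs at most [largest_part sigma - 1]
    times per class, so the largest part of an edge is not monochromatic; [k < r] excludes rainbow
    edges. *)
Lemma pos_mod_colourable n r q sigma k :
    0 < n -> 0 < largest_part sigma -> 0 < k -> k < r -> k <= q ->
    q <= k * (largest_part sigma - 1) ->
  NMNR_colourable (sigma_hypergraph n r q sigma) k.
Proof.
move=> n_gt0 Delta_gt0 k_gt0 kr kq qk.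
pose c (v : vertex n q) := Ordinal (ltn_pmod v.2 k_gt0); exists c; split.
  move=> a; exists (Ordinal n_gt0, Ordinal (leq_trans (ltn_ord a) kq)).
  by apply: val_inj => /=; rewrite modn_small.
move=> R Re; split; last first.
  move=> rain; have := subset_leq_card (subsetT (c @: R)).
  rewrite card_in_imset // cardsT card_ord.
  by move: Re; rewrite inE => /andP[/eqP ->]; lia.
have [|i cardi mono] := edge_vclass Re (@largest_part_mem sigma _); first by [].
set S := _ :&: _ in cardi.
have /card_gt0P[v0 v0S] : 0 < #|S| by rewrite cardi.
have same v : v \in S -> v.2 %% k = v0.2 %% k.
  by move: v0S => /setIP[v0R _] /setIP[vR _]; have [] := mono _ _ vR v0R.
have d_gt0 : 0 < largest_part sigma - 1.
  by case: posnP qk => // ->; rewrite muln0; lia.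
pose h (v : vertex n q) : 'I_(largest_part sigma - 1) :=
  insubd (Ordinal d_gt0) (v.2 %/ k).
have h_inj : {in S &, injective h}.
  move=> [i1 u] [i2 v] uS vS /(congr1 val); rewrite !val_insubd /=.
  rewrite !ltn_divLR // ![(_ - 1) * k]mulnC.
  rewrite !(leq_trans (ltn_ord _) qk) => uv.
  have := same _ uS; have := same _ vS => /= mv mu.
  move: uS vS; rewrite !inE /= => /andP[_ /eqP ->] /andP[_ /eqP ->].
  by congr pair; apply: val_inj; rewrite /= (divn_eq u k) (divn_eq v k) uv mu mv.
have := subset_leq_card (subsetT (h @: S)).
by rewrite card_in_imset // cardsT card_ord; lia.
Qed.

(** * Assembling the spectrum and its gap *)

Theorem theorem3p2 (r : nat) (sigma : seq nat) (n q : nat)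
  (hr : 3 <= r)
  (hsigma : is_partition r sigma)
  (hs : 2 <= num_parts sigma)
  (hdelta : smallest_part sigma = 1)
  (hDelta : 1 < largest_part sigma)
  (hn : r * (num_parts sigma - 1) + num_parts sigma < n)
  (hq : q = (r - 1) * (largest_part sigma - 1)) :
  NMNR_gap_between (sigma_hypergraph n r q sigma)
    (r - 1) (ceil_div n (num_parts sigma - 1)) /\
  [/\ forall k : nat, 0 < k -> k <= r - 2 ->
        ~ NMNR_colourable (sigma_hypergraph n r q sigma) k,
      NMNR_colourable (sigma_hypergraph n r q sigma) (r - 1),
      ~ NMNR_colourable (sigma_hypergraph n r q sigma) r &
      forall k : nat, ceil_div n (num_parts sigma - 1) <= k -> k <= n ->
        NMNR_colourable (sigma_hypergraph n r q sigma) k].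
Proof.
rewrite /num_parts in hs hn *; set s := size sigma in hs hn *.
have d_gt0 : 0 < largest_part sigma - 1 by lia.
have dS : (largest_part sigma - 1).+1 = largest_part sigma by lia.
have q_ge : r - 1 <= q by rewrite hq leq_pmulr; lia.
have q_gt0 : 0 < q by lia.
have n_ceil : n <= ceil_div n (s - 1) * (s - 1) by apply: ceil_div_leq; lia.
(* Otherwise [n <= r * (s - 1)], against [hn]; this places [r] strictly inside the gap. *)
have r_ceil : r < ceil_div n (s - 1).
  rewrite ltnNge; apply/negP=> ceil_r.
  by have := leq_mul ceil_r (leqnn (s - 1)); lia.
have ceil_n : ceil_div n (s - 1) <= n.
  rewrite /ceil_div -[X in _ <= X](@mulnK n (s - 1)); last lia.
  by apply: leq_div2r; nia.
have below k : 0 < k -> k <= r - 2 ->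
    ~ NMNR_colourable (sigma_hypergraph n r q sigma) k.
  move=> k_gt0 kr [c [_ proper]].
  have := card_repeating_classes hsigma (fun R Re => (proper R Re).1).
  move=> /(_ ltac:(lia)); set rep := repeating_classes _ _ => rep_small.
  (* At most [k * (s - 1) < n] classes repeat a colour. *)
  have /card_gt0P[i] : 0 < #|~: rep|.
    by have := cardsC rep; rewrite card_ord; nia.
  rewrite inE /rep -dS => /(class_colours_lower_bound d_gt0 hq).
  apply/negP; rewrite -ltnNge (@leq_ltn_trans k) //; last lia.
  by rewrite -[X in _ <= X]card_ord max_card.
have at_pred : NMNR_colourable (sigma_hypergraph n r q sigma) (r - 1).
  by apply: pos_mod_colourable; rewrite ?hq //; lia.
have at_r : ~ NMNR_colourable (sigma_hypergraph n r q sigma) r.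
  move=> [c [surj proper]].
  have := card_repeating_classes hsigma (fun R Re => (proper R Re).1).
  move=> /(_ ltac:(lia)); set rep := repeating_classes _ _ => rep_small.
  (* By [hn], more than [s] classes remain outside [rep], each with at least [r - 1] colours. *)
  have [|||R Re rain] :=
    @ex_rainbow_edge _ _ _ c sigma (~: rep) hsigma _ hs q_gt0 surj.
  - by rewrite -hdelta smallest_part_mem //; lia.
  - by move=> i; rewrite inE /rep -dS => /(class_colours_lower_bound d_gt0 hq).
  - by have := cardsC rep; rewrite card_ord; lia.
  - exact: (proper R Re).2.
have above k : ceil_div n (s - 1) <= k -> k <= n ->
    NMNR_colourable (sigma_hypergraph n r q sigma) k.
  move=> ck kn; apply: class_mod_colourable => //; first lia.
  by apply: leq_trans n_ceil _; rewrite leq_mul2r ck orbT.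
split; last by split.
split.
- by split; [lia | exact: at_pred].
- by split; [lia | exact: above].
- by exists r; split; [lia | case].
Qed.
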